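(* For any sequence of operations on multi-root hollow heaps (as defined and implemented in the context), starting with no heaps, the amortized time per operation is $O(1)$ for each operation other than delete and delete-min, and $O(\log N)$ for each delete or delete-min on a heap of $N$ nodes (full and hollow).
   Context: Heaps. A heap stores a finite set of items, each with a key from a totally ordered universe, and supports: make-heap() (return an empty heap); find-min($h$) (return an item of minimum key in $h$, or null if $h$ is empty); insert($e,k,h$) (add item $e$, which is in no heap, with key $k$); delete-min($h$) (delete from non-empty $h$ the item that find-min($h$) returns); meld($h_1,h_2$) (return a heap containing all items of the item-disjoint heaps $h_1,h_2$); decrease-key($e,k,h$) (given an item $e$ in $h$ with key greater than $k$, change its key to $k$); delete($e,h$) (delete item $e$ from $h$). Heaps passed as arguments are destroyed; decrease-key and delete are given the location of $e$. Nodes. Nodes hold items: each node holds at most one item, and is full if it holds one and hollow otherwise; each item in a heap is held by exactly one node; a newly created node is full and a hollow node never becomes full again. Each node $u$ has a key $u.key$ (the current key of its item if $u$ is full; if $u$ is hollow, the key its item had just before leaving $u$) and a non-negative integer rank $u.rank$. A tree (or dag) of nodes with arcs from parent to child is heap-ordered if $v.key\le w.key$ for every arc $(v,w)$. For two full roots, link makes the one of larger key (ties broken arbitrarily) a child of the other; the new child is the loser and the other the winner. A ranked link is a link of two roots of equal rank and increases the winner's rank by one. Multi-root hollow heap. It is either empty or a set of heap-ordered rooted trees of nodes, together with a pointer to a full root whose key is minimum among all nodes (the minimum node). make-heap returns the empty set of trees; find-min returns the item in the minimum node; meld returns one heap if the other is empty, and otherwise unites the two sets of trees and updates the minimum node;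 insert($e,k,h$) creates a new full node of rank 0 holding $e$ with key $k$ and melds this one-node heap with $h$. decrease-key($e,k,h$), with $u$ the node holding $e$: if $u$ is a root one may simply set $u.key=k$ and update the minimum node; otherwise create a new node $v$, move $e$ from $u$ to $v$ (so $u$ becomes hollow), set $v.key=k$ and $v.rank=\max\{0,u.rank-2\}$, move every child of $u$ of rank less than $v.rank$ (with its subtree) to become a child of $v$, and meld the tree rooted at $v$ with the heap. delete($e,h$) removes $e$ from the node $u$ holding it, making $u$ hollow; if $u$ is not the minimum node this completes the operation; otherwise, while some root is hollow, destroy such a root, making its children roots; then do ranked links while two roots have equal rank; finally make a root of minimum key the minimum node. delete-min($h$) performs delete on the item in the minimum node. Implementation. The children of each node are kept in a singly-linked list in decreasing order by rank (a ranked link makes the loser the first child of the winner; a decrease-key moving an item from $u$ to $v$ moves to $v$ all but the first two children of $u$ if $u.rank>2$, and no children otherwise); the roots of each heap are kept in a singly-linked circular list accessed via the minimum node; and during delete, roots of equal rank to be linked are found using an array of roots indexed by rank. *)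

(* Defs.v *)
From HB Require Import structures.
From mathcomp Require Import all_boot all_order.

Set Implicit Arguments.
Unset Strict Implicit.
Unset Printing Implicit Defensive.

Import Order.TTheory.

(* Time is measured in elementary actions: an action performs a bounded number
   of pointer accesses, node creations or destructions, array accesses and key
   comparisons.  The places where a single action acts on a whole [seq] are
   those where the linked lists allow it; they are pointed out below. *)

Section HollowHeaps.

Variables (d : Order.disp_t) (K : orderType d) (E : eqType).

(* A node (item if it is full, [None] if it is hollow; key; rank; children)
   together with the subtree rooted at it.  Nodes need no identity of their
   own: operations designate a node only through the item it holds. *)
Inductive tree := Node of option E & K & nat & seq tree.

Definition item (t : tree) := let: Node x _ _ _ := t in x.
Definition key (t : tree) := let: Node _ k _ _ := t in k.
Definition rank (t : tree) := let: Node _ _ r _ := t in r.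
Definition children (t : tree) := let: Node _ _ _ c := t in c.

Definition hollow (t : tree) : bool := ~~ isSome (item t).

Fixpoint tree_nodes (t : tree) : nat :=
  let: Node _ _ _ c := t in (sumn (map tree_nodes c)).+1.

Fixpoint tree_items (t : tree) : seq E :=
  let: Node x _ _ c := t in seq_of_opt x ++ flatten (map tree_items c).

(* The circular list of roots, read from the minimum node, through which it is
   accessed: the head is the minimum node. *)
Definition heap := seq tree.

Definition heap_nodes (h : heap) : nat := sumn (map tree_nodes h).
Definition heap_items (h : heap) : seq E := flatten (map tree_items h).

Definition find_min (h : heap) : option E :=
  if h is m :: _ then item m else None.

(* Exchanging the successors of the two minimum nodes [m1] and [m2] turns the
   two circular lists into one. *)
Inductive meld : heap -> heap -> heap -> Prop :=
| MeldNilL h : meld [::] h h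
| MeldNilR h : meld h [::] h
| MeldL m1 l1 m2 l2 : (key m1 <= key m2)%O ->
    meld (m1 :: l1) (m2 :: l2) (m1 :: l2 ++ m2 :: l1)
| MeldR m1 l1 m2 l2 : (key m2 <= key m1)%O ->
    meld (m1 :: l1) (m2 :: l2) (m2 :: l1 ++ m1 :: l2).

Definition insert (e : E) (k : K) (h h' : heap) : Prop :=
  meld [:: Node (Some e) k 0 [::]] h h'.

(* [update u u' h h']: [h'] results from [h] by changing one occurrence of the
   node [u], at any depth, into [u'].  It is only used with [u] full, so that
   its item determines the occurrence; since the location of the item is given,
   the update is done in place. *)
Inductive update (u u' : tree) : seq tree -> seq tree -> Prop :=
| UpdateHere l1 l2 : update u u' (l1 ++ u :: l2) (l1 ++ u' :: l2)
| UpdateBelow l1 l2 x k r c c' : update u u' c c' ->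
    update u u' (l1 ++ Node x k r c :: l2) (l1 ++ Node x k r c' :: l2).

(* The children of a full node of rank [r] have ranks [r - 1], ..., [0] in this
   order, so those of rank less than [r - 2] (truncated, that is
   max {0, r - 2}) are all but the first two if [r > 2], and none otherwise.
   They are moved by cutting the list after its second element. *)
Definition kept_children (r : nat) (c : seq tree) : seq tree :=
  if 2 < r then take 2 c else c.
Definition moved_children (r : nat) (c : seq tree) : seq tree :=
  if 2 < r then drop 2 c else [::].

(* [decrease_key e k h n h'], with [n] the time taken.  The first two rules set
   the key of a root in place (the first one when that root is, or becomes, the
   minimum node, so that the circular list is now accessed through it); the
   last one may be used for any node, root or not.  Its actions are: create
   the new node, move the item, move the children, meld. *)
Inductive decrease_key (e : E) (k : K) : heap -> nat -> heap -> Prop :=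
| DecreaseRootMin l1 ku r c l2 :
    (k < ku)%O -> (if l1 is m :: _ then (k <= key m)%O else true) ->
    decrease_key e k (l1 ++ Node (Some e) ku r c :: l2)
      2 (Node (Some e) k r c :: l2 ++ l1)
| DecreaseRootNonMin m l1 ku r c l2 :
    (k < ku)%O -> (key m <= k)%O ->
    decrease_key e k (m :: l1 ++ Node (Some e) ku r c :: l2)
      2 (m :: l1 ++ Node (Some e) k r c :: l2)
| DecreaseNew ku r c h h1 h' :
    (k < ku)%O ->
    update (Node (Some e) ku r c) (Node None ku r (kept_children r c)) h h1 ->
    meld [:: Node (Some e) k (r - 2) (moved_children r c)] h1 h' ->
    decrease_key e k h 4 h'.

(* [destroy l f n]: examining the roots [l] in any order, and destroying the
   hollow ones, whose children become roots one by one and are examined in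
   their turn, leaves the full roots [f] after time [n]. *)
Inductive destroy : seq tree -> seq tree -> nat -> Prop :=
| DestroyDone : destroy [::] [::] 0
| DestroyFull l1 t l2 f n : ~~ hollow t ->
    destroy (l1 ++ l2) f n ->
    destroy (l1 ++ t :: l2) (t :: f) (1 + n)
| DestroyHollow l1 t l2 f n : hollow t ->
    destroy (l1 ++ children t ++ l2) f n ->
    destroy (l1 ++ t :: l2) f (2 + size (children t) + n).

Definition lose_to (l w : tree) : tree :=
  Node (item w) (key w) (rank w).+1 (l :: children w).

Inductive ranked_link (t u : tree) : tree -> Prop :=
| LinkL : rank t = rank u -> (key t <= key u)%O -> ranked_link t u (lose_to u t)
| LinkR : rank t = rank u -> (key u <= key t)%O -> ranked_link t u (lose_to t u).

(* The array of roots indexed by rank; [nth] and [set_nth] give it one entry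
   for each rank up to the largest rank met. *)
Definition rank_array := seq (option tree).

(* [link_roots l A n B]: starting from the array [A], taking the roots [l] in
   any order and doing the ranked links leads to the array [B] in time [n]. *)
Inductive link_roots : seq tree -> rank_array -> nat -> rank_array -> Prop :=
| LinkDone A : link_roots [::] A 0 A
| LinkPlace l1 t l2 A n B :
    nth None A (rank t) = None ->
    link_roots (l1 ++ l2) (set_nth None A (rank t) (Some t)) n B ->
    link_roots (l1 ++ t :: l2) A (1 + n) B
| LinkWith l1 t l2 u w A n B :
    nth None A (rank t) = Some u -> ranked_link t u w ->
    link_roots (w :: l1 ++ l2) (set_nth None A (rank t) None) n B ->
    link_roots (l1 ++ t :: l2) A (2 + n) B.

Definition min_first (h : heap) : bool :=
  if h is m :: l then all (fun t => key m <= key t)%O l else true.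

(* [delete e h n h'], with [n] the time taken.  In the second rule the entries
   of the array, one at a time, are initialized and finally scanned to form the
   new circular list of roots and find its minimum node. *)
Inductive delete (e : E) : heap -> nat -> heap -> Prop :=
| DeleteNonMin k r c h h' :
    find_min h <> Some e ->
    update (Node (Some e) k r c) (Node None k r c) h h' ->
    delete e h 1 h'
| DeleteMinNode k r c l f n1 n2 B i :
    destroy (Node None k r c :: l) f n1 ->
    link_roots f [::] n2 B ->
    min_first (rot i (pmap id B)) ->
    delete e (Node (Some e) k r c :: l)
      (1 + n1 + n2 + 2 * size B) (rot i (pmap id B)).

(* Heaps are designated by natural numbers: entry [i] of the state is the
   [i]-th heap made, or [None] if it has been destroyed by a meld.  An
   operation that destroys a heap and returns another one stores the latter
   under the same number; [Meld i j] stores its result under [i]. *)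
Definition state := seq (option heap).

Inductive operation :=
| MakeHeap
| FindMin of nat
| Insert of E & K & nat
| DeleteMin of nat
| Meld of nat & nat
| DecreaseKey of E & K & nat
| Delete of E & nat.

(* An item is inserted only when it is in no heap, hence distinct heaps are
   always item-disjoint. *)
Inductive step : state -> operation -> nat -> state -> Prop :=
| StepMakeHeap s : step s MakeHeap 1 (rcons s (Some [::]))
| StepFindMin s i h :
    nth None s i = Some h -> step s (FindMin i) 1 s
| StepInsert s e k i h h' :
    nth None s i = Some h ->
    (forall j h2, nth None s j = Some h2 -> e \notin heap_items h2) ->
    insert e k h h' ->
    step s (Insert e k i) 2 (set_nth None s i (Some h'))
| StepDeleteMin s i h e n h' :
    nth None s i = Some h -> find_min h = Some e -> delete e h n h' ->
    step s (DeleteMin i) (1 + n) (set_nth None s i (Some h'))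
| StepMeld s i j h1 h2 h :
    i != j -> nth None s i = Some h1 -> nth None s j = Some h2 ->
    meld h1 h2 h ->
    step s (Meld i j) 1 (set_nth None (set_nth None s j None) i (Some h))
| StepDecreaseKey s e k i h n h' :
    nth None s i = Some h -> decrease_key e k h n h' ->
    step s (DecreaseKey e k i) n (set_nth None s i (Some h'))
| StepDelete s e i h n h' :
    nth None s i = Some h -> delete e h n h' ->
    step s (Delete e i) n (set_nth None s i (Some h')).

Record event := Event {
  before : state;
  performed : operation;
  time : nat
}.

Inductive execution : seq event -> state -> Prop :=
| ExecStart : execution [::] [::]
| ExecStep tr s o n s' : execution tr s -> step s o n s' ->
    execution (rcons tr (Event s o n)) s'.

Definition nodes_of (s : state) (i : nat) : nat :=
  heap_nodes (odflt [::] (nth None s i)).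

(* The amortized time allowed to an operation performed in state [s].  The
   logarithm is floor (log_2 N) + 1, so that the bound O(log N) also makes sense
   for [N = 1], where log N vanishes. *)
Definition allowance (c : nat) (s : state) (o : operation) : nat :=
  match o with
  | Delete _ i | DeleteMin i => c * (trunc_log 2 (nodes_of s i)).+1
  | _ => c
  end.

End HollowHeaps.

(* Main.v *)
Require Import Defs.
From HB Require Import structures.
From mathcomp Require Import all_boot all_order.
From mathcomp Require Import zify.

(** Potential argument: every full root carries 4 units, and every hollow node
    with [m] children, root or not, carries [2 + 5 * m] units, which pay for its
    destruction and for turning its children into roots.  A full node of rank
    [r] has children of ranks [r - 1, ..., 0], and a node that becomes hollow
    keeps at least the first two of them, so the number of nodes below a node at
    least doubles when its rank increases by two: ranks are at most
    [2 log N + 1].  Hence only [delete] can create a hollow node with more than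
    two children, and it then pays for [O(log N)] of them.  The linking phase
    costs at most 3 per root, and all but [O(log N)] roots lose their 4 units. *)

Set Implicit Arguments.
Unset Strict Implicit.
Unset Printing Implicit Defensive.

(** * Arrays of optional entries *)

(** Serves both the rank array and the state. An index beyond the end fits the same form: the
    default read there is [None], and the [None] entries that [set_nth] pads with vanish under
    [pmap id]. *)
Lemma pmap_set_nth (T : Type) (A : seq (option T)) (r : nat) :
  exists l1 l2, pmap id A = l1 ++ seq_of_opt (nth None A r) ++ l2 /\
    forall y, pmap id (set_nth None A r y) = l1 ++ seq_of_opt y ++ l2.
Proof.
have [ltrA | leAr] := ltnP r (size A).
  exists (pmap id (take r A)), (pmap id (drop r.+1 A)); split.
    rewrite -{1}(cat_take_drop r A) (drop_nth None ltrA) pmap_cat /=.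
    by case: (nth None A r).
  by move=> y; rewrite set_nthE ltrA pmap_cat /=; case: y.
exists (pmap id A), [::]; split; first by rewrite nth_default //= cats0.
move=> y; rewrite set_nthE ltnNge leAr /= pmap_cat cats0; congr (_ ++ _).
by elim: (r - size A) => //=; case: y.
Qed.

Lemma size_pmap_le (T : Type) (A : seq (option T)) : size (pmap id A) <= size A.
Proof. by rewrite size_pmap count_size. Qed.

Fixpoint downto (n : nat) : seq nat :=
  if n is m.+1 then m :: downto m else [::].

Section HollowHeapAnalysis.

Variables (d : Order.disp_t) (K : orderType d) (E : eqType).
Local Notation tree := (tree K E).
Local Notation heap := (heap K E).
Local Notation full := (fun t : tree => ~~ hollow t).

(** * Ranks and subtree sizes *)

(** For a hollow node only the first two child ranks are prescribed, since decrease-key may have cut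
    off the rest; [take 2] on both sides also covers ranks below 2. *)
Fixpoint well_ranked (t : tree) : bool :=
  let: Node x _ r c := t in
  all well_ranked c &&
  (if x is Some _ then map (@rank _ K E) c == downto r
   else take 2 (map (@rank _ K E) c) == take 2 (downto r)).

Lemma well_ranked_take2 (t : tree) : well_ranked t ->
  take 2 (map (@rank _ K E) (children t)) = take 2 (downto (rank t)).
Proof. by case: t => [[x|] k r c] /= /andP[_ /eqP // ->]. Qed.

Lemma well_ranked_children (t : tree) :
  well_ranked t -> all well_ranked (children t).
Proof. by case: t => [x k r c] /= /andP[]. Qed.

Lemma tree_nodesE (t : tree) : tree_nodes t = (heap_nodes (children t)).+1.
Proof. by case: t. Qed.

(** Strong induction on the rank: at rank [r.+2] the first two children have ranks [r.+1] and [r],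
    so each subtree has at least [2 ^ r./2] nodes, and together they give the next power. *)
Lemma exp2_rank_le_nodes (t : tree) :
  well_ranked t -> 2 ^ (rank t)./2 <= tree_nodes t.
Proof.
have [n] := ubnP (rank t); elim: n t => // n IH t ltrn wt.
have := well_ranked_take2 wt; have := well_ranked_children wt.
rewrite tree_nodesE.
case: (rank t) ltrn => [|[|r]] //= ltrn.
case: (children t) => [|a [|b c]] //= /and3P[wa wb _] [ra rb _].
have := IH a _ wa; have := IH b _ wb; rewrite ra rb /heap_nodes /= => Hb Ha.
have le2: 2 ^ r./2 <= 2 ^ (uphalf r).
  by rewrite leq_exp2l // uphalf_half leq_addl.
have := Ha ltac:(lia); have := Hb ltac:(lia).
by rewrite expnS; lia.
Qed.

(** The successor accounts for odd ranks, whose half is rounded down. *)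
Lemma rank_le_log (t : tree) (N : nat) :
  well_ranked t -> tree_nodes t <= N -> rank t <= (trunc_log 2 N).*2.+1.
Proof.
move=> wt leN.
have leN2 := leq_trans (exp2_rank_le_nodes wt) leN.
have := @trunc_log_max 2 N (rank t)./2 isT leN2.
lia.
Qed.

(** * The potential *)

(** Destroying a hollow root with [m] children takes time [2 + m] and creates at most [m] full
    roots, worth 4 units each: in all [2 + 5 * m]. *)
Fixpoint debt (t : tree) : nat :=
  let: Node x _ _ c := t in
  sumn (map debt c) + (if x is Some _ then 0 else 2 + 5 * size c).

Definition debts (l : seq tree) : nat := sumn (map debt l).

Definition potential (h : heap) : nat := 4 * count full h + debts h.

Lemma debts_cat (l1 l2 : seq tree) : debts (l1 ++ l2) = debts l1 + debts l2.
Proof. by rewrite /debts map_cat sumn_cat. Qed.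

Lemma debts_cons (t : tree) (l : seq tree) : debts (t :: l) = debt t + debts l.
Proof. by []. Qed.

Lemma heap_nodes_cat (l1 l2 : seq tree) :
  heap_nodes (l1 ++ l2) = heap_nodes l1 + heap_nodes l2.
Proof. by rewrite /heap_nodes map_cat sumn_cat. Qed.

Lemma heap_nodes_cons (t : tree) (l : seq tree) :
  heap_nodes (t :: l) = tree_nodes t + heap_nodes l.
Proof. by []. Qed.

Lemma potential_cat (l1 l2 : seq tree) :
  potential (l1 ++ l2) = potential l1 + potential l2.
Proof. by rewrite /potential count_cat debts_cat; lia. Qed.

Lemma potential_cons (t : tree) (l : seq tree) :
  potential (t :: l) = 4 * ~~ hollow t + debt t + potential l.
Proof. by rewrite /potential debts_cons /=; lia. Qed.

(** * Melding and updates in place *)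

Lemma well_ranked_meld (h1 h2 h : heap) : meld h1 h2 h ->
  all well_ranked h = all well_ranked h1 && all well_ranked h2.
Proof.
by case=> [l|l|m1 l1 m2 l2 _|m1 l1 m2 l2 _] /=; rewrite ?andbT ?all_cat //=;
  case: (well_ranked m1); case: (well_ranked m2);
  case: (all _ l1); case: (all _ l2).
Qed.

Lemma potential_meld (h1 h2 h : heap) :
  meld h1 h2 h -> potential h = potential h1 + potential h2.
Proof.
by case=> [l|l|m1 l1 m2 l2 _|m1 l1 m2 l2 _];
  rewrite ?[potential [::]]/= ?(potential_cat, potential_cons);
  rewrite /potential /debts /=; lia.
Qed.

Lemma map_rank_update (u u' : tree) (h h' : seq tree) :
  update u u' h h' -> rank u' = rank u ->
  map (@rank _ K E) h' = map (@rank _ K E) h.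
Proof. by case=> [l1 l2|l1 l2 x k r c c' _] E1; rewrite !map_cat /= ?E1. Qed.

Lemma size_update (u u' : tree) (h h' : seq tree) :
  update u u' h h' -> size h' = size h.
Proof. by case=> *; rewrite !size_cat. Qed.

(** The condition at an ancestor reads only the ranks of its children, so it survives as long as the
    replaced node keeps its rank. *)
Lemma well_ranked_update (u u' : tree) (h h' : seq tree) :
  update u u' h h' -> all well_ranked h ->
  well_ranked u /\
  (rank u' = rank u -> well_ranked u' -> all well_ranked h').
Proof.
elim=> {h h'} [l1 l2|l1 l2 x k r c c' upd IH].
  by rewrite !all_cat /= => /and3P[-> -> ->]; split=> // _ ->.
rewrite !all_cat /= => /and3P[-> /andP[/IH[wu IHu] wr] ->]; split=> // ru wu'.
by rewrite IHu //= (map_rank_update upd ru) wr.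
Qed.

Lemma nodes_update (u u' : tree) (h h' : seq tree) :
  update u u' h h' -> tree_nodes u <= heap_nodes h.
Proof.
elim=> {h h'} [l1 l2|l1 l2 x k r c c' upd IH];
  rewrite heap_nodes_cat heap_nodes_cons.
  lia.
by rewrite [tree_nodes (Node _ _ _ _)]/= -/(heap_nodes c); lia.
Qed.

Lemma debts_update (u u' : tree) (h h' : seq tree) :
  update u u' h h' -> debts h' + debt u = debts h + debt u'.
Proof.
elim=> {h h'} [l1 l2|l1 l2 x k r c c' upd IH]; rewrite !debts_cat !debts_cons.
  lia.
by rewrite /= -/(debts _) -/(debts _) (size_update upd); lia.
Qed.

(** An inequality, because [u] may itself be a full root, which then stops counting. *)
Lemma potential_update (u u' : tree) (h h' : seq tree) :
  update u u' h h' -> hollow u' ->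
  potential h' + debt u <= potential h + debt u'.
Proof.
move=> upd hu'; have := debts_update upd; rewrite /potential => Ed.
suff: count full h' <= count full h by lia.
by case: upd => *; rewrite !count_cat /= ?hu' //=; lia.
Qed.

(** * Decrease-key *)

Lemma well_ranked_decrease_key (e : E) (k : K) (h h' : heap) (n : nat) :
  decrease_key e k h n h' -> all well_ranked h -> all well_ranked h'.
Proof.
case=> {h h' n} [l1 ku r c l2 _ _|m l1 ku r c l2 _ _|ku r c h h1 h' _ upd mld].
- by rewrite !all_cat /= all_cat => /and3P[-> -> ->].
- by rewrite /= !all_cat.
case/(well_ranked_update upd) => /= /andP[wc /eqP rc] H.
rewrite (well_ranked_meld mld) /= andbT; apply/andP; split.
  (* For [r] at most 2 the truncated [r - 2] is 0 and no child moves; otherwise the moved ranks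
     [r - 3, ..., 0] are exactly those of a full node of rank [r - 2]. *)
  rewrite /moved_children; case: r rc {upd mld H} => [|[|[|r]]] //=.
  case: c wc => [|a [|b c]] //= /and3P[_ _ wc] [_ _ rc].
  by rewrite drop0 wc rc eqxx.
apply: H => //=; rewrite /kept_children; case: ifP => r2.
  rewrite map_take rc take_takel // eqxx andbT.
  by move: wc; rewrite -{1}(cat_take_drop 2 c) all_cat => /andP[].
by rewrite wc rc eqxx.
Qed.

Lemma size_downto (n : nat) : size (downto n) = n.
Proof. by elim: n => //= n ->. Qed.

(** The worst case gives 20: time 4, 4 units for the new full root, and debt [2 + 5 * 2] for the
    hollow node left behind. *)
Lemma amortized_decrease_key (e : E) (k : K) (h h' : heap) (n : nat) :
  decrease_key e k h n h' -> all well_ranked h ->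
  n + potential h' <= 20 + potential h.
Proof.
case=> {h h' n} [l1 ku r c l2 _ _|m l1 ku r c l2 _ _|
    ku r c h h1 h' _ upd mld] wh.
- by rewrite potential_cat !potential_cons potential_cat /=; lia.
- by rewrite !potential_cons !potential_cat !potential_cons /=; lia.
have [/= /andP[_ /eqP rc] _] := well_ranked_update upd wh.
rewrite (potential_meld mld) potential_cons /=.
have := potential_update upd isT => /=.
(* If nothing is cut, then [r] is at most 2 and the node has exactly [r] children. *)
have sc: size (kept_children r c) <= 2.
  rewrite /kept_children; case: ltnP => r2.
    by rewrite size_take_min geq_minl.
  by rewrite -(size_map (@rank _ K E)) rc size_downto.
have: debts c = debts (kept_children r c) + debts (moved_children r c).
  rewrite /kept_children /moved_children; case: ifP => _; last by rewrite addn0.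
  by rewrite -debts_cat cat_take_drop.
by rewrite -!/(debts _) /potential [debts [::]]/debts /=; lia.
Qed.

(** * Deletion *)

(** Of the 4 units of each full root, one pays for examining it here and 3 are left for the linking
    phase. *)
Lemma destroy_correct (l f : seq tree) (n : nat) :
  destroy l f n -> all well_ranked l ->
  [/\ all well_ranked f, all full f, heap_nodes f <= heap_nodes l &
      n + 3 * size f + debts f <= potential l].
Proof.
elim=> {l f n} [|l1 t l2 f n ft _ IH|l1 t l2 f n ht _ IH] //.
- rewrite all_cat /= => /and3P[w1 wt w2].
  have [|wf ff nf tf] := IH; first by rewrite all_cat w1.
  split; rewrite /= ?wt ?ft //.
    by move: nf; rewrite !heap_nodes_cat !heap_nodes_cons; lia.
  by move: tf; rewrite !potential_cat potential_cons debts_cons ft; lia.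
rewrite all_cat /= => /and3P[w1 wt w2].
have [|wf ff nf tf] := IH.
  by rewrite !all_cat w1 well_ranked_children.
split=> //.
  by move: nf; rewrite !heap_nodes_cat !heap_nodes_cons tree_nodesE; lia.
move: tf; rewrite !potential_cat potential_cons ht.
case: t ht {wt IH wf ff nf} => [[//|] k r c] _ /=.
rewrite -/(debts c) {2}/potential.
by have := count_size full c; lia.
Qed.

(** Equal ranks are what keeps the winner well ranked: putting the loser's rank [r] before
    [downto r] gives [downto r.+1]. *)
Lemma ranked_link_correct (t u w : tree) :
  ranked_link t u w -> well_ranked t -> well_ranked u -> full t -> full u ->
  [/\ well_ranked w, full w, debt w = debt t + debt u &
      tree_nodes w = tree_nodes t + tree_nodes u].
Proof.
case: t u => [[x|] k r c] [[x'|] k' r' c'] //.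
by case=> /= rr _ /andP[wc /eqP rc] /andP[wc' /eqP rc'] _ _;
   rewrite wc wc' rr rc rc' ?rr !eqxx; split=> //; rewrite ?rr ?eqxx //; lia.
Qed.

(** A pending root is worth 3 and a root in the array 2: placing one releases 1, while a link
    empties an entry and releases 2, exactly the times taken. Links preserve the total number of
    nodes, so the same [N] bounds every rank met and hence the array size. *)
Lemma link_roots_correct (N : nat) (l : seq tree) (A : rank_array K E) (n : nat)
    (B : rank_array K E) :
  link_roots l A n B ->
  all well_ranked (l ++ pmap id A) -> all full (l ++ pmap id A) ->
  heap_nodes (l ++ pmap id A) <= N -> size A <= (trunc_log 2 N).*2.+2 ->
  [/\ all well_ranked (pmap id B), all full (pmap id B),
      debts (pmap id B) = debts (l ++ pmap id A),
      size B <= (trunc_log 2 N).*2.+2 &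
      n + 2 * size (pmap id B) = 3 * size l + 2 * size (pmap id A)].
Proof.
elim=> {l A n B} [A|l1 t l2 A n B At _ IH|l1 t l2 u w A n B At tuw _ IH].
- by move=> *; split.
- have [a1 [a2 [EA Eset]]] := pmap_set_nth A (rank t).
  move: IH; rewrite Eset EA At /= => IH.
  rewrite !all_cat /= !heap_nodes_cat !heap_nodes_cons -!andbA.
  move=> /and5P[w1 wt w2 wa1 wa2] /and5P[f1 ft f2 fa1 fa2] leN sA.
  have [||||wB fB dB sB tB] := IH.
  + by rewrite !all_cat /= w1 w2 wa1 wt.
  + by rewrite !all_cat /= f1 f2 fa1 ft.
  + by move: leN; clear; rewrite !heap_nodes_cat heap_nodes_cons; lia.
  + rewrite size_set_nth geq_max sA andbT ltnS.
    by apply: rank_le_log => //; move: leN; clear; lia.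
  split=> //; first by rewrite dB !(debts_cat, debts_cons); clear; lia.
  by move: tB; clear; rewrite !size_cat /=; lia.
have [a1 [a2 [EA Eset]]] := pmap_set_nth A (rank t).
move: IH; rewrite Eset EA At /= => IH.
rewrite !all_cat /= !heap_nodes_cat !heap_nodes_cons -!andbA.
move=> /and5P[w1 wt w2 wa1 /andP[wu wa2]].
move=> /and5P[f1 ft f2 fa1 /andP[fu fa2]] leN sA.
have [ww fw dw nw] := ranked_link_correct tuw wt wu ft fu.
have [||||wB fB dB sB tB] := IH.
- by rewrite !all_cat ww w1 w2 wa1.
- by rewrite !all_cat fw f1 f2 fa1.
- move: leN; rewrite heap_nodes_cons !heap_nodes_cat nw; clear; lia.
- have: rank t <= (trunc_log 2 N).*2.+1.
    by apply: rank_le_log => //; move: leN; clear; lia.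
  by rewrite size_set_nth geq_max sA andbT ltnS.
split=> //; first by rewrite dB !(debts_cat, debts_cons) dw; clear; lia.
by move: tB; clear; rewrite !size_cat /=; lia.
Qed.

(** With [L] the logarithm, the new hollow node of rank at most [2 * L + 1] brings a debt of at most
    [10 * L + 7]. At the minimum node, scanning the array and the 2 units per final root not covered
    by the linking phase add at most [4 * (2 * L + 2)]; hence the factor 18. *)
Lemma delete_correct (e : E) (h h' : heap) (n : nat) :
  delete e h n h' -> all well_ranked h ->
  all well_ranked h' /\
  n + potential h' <= 18 * (trunc_log 2 (heap_nodes h)).+1 + potential h.
Proof.
have hollowed k r c : well_ranked (Node (Some e) k r c) ->
    well_ranked (Node None k r c : tree) /\ size c = r.
  move=> /= /andP[-> /eqP rc]; rewrite rc eqxx; split=> //.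
  by rewrite -(size_map (@rank _ K E)) rc size_downto.
case=> {h h' n} [k r c h h' _ upd|k r c l f n1 n2 B i destr link _] wh.
  have [wu H] := well_ranked_update upd wh.
  have [wu' sc] := hollowed _ _ _ wu.
  split; first exact: H.
  have := potential_update upd isT.
  by have := rank_le_log wu (nodes_update upd); rewrite /= sc; lia.
have /andP[wu wl] : well_ranked (Node (Some e) k r c) && all well_ranked l.
  by [].
have [wu' sc] := hollowed _ _ _ wu.
have wh': all well_ranked (Node None k r c :: l) by apply/andP.
have [wf ff nf tf] := destroy_correct destr wh'.
set N := heap_nodes _.
have [||||wB fB dB sB tB] := link_roots_correct (N := N) link;
  rewrite /= ?cats0 //.
have rN : r <= (trunc_log 2 N).*2.+1.
  by apply: rank_le_log wu _; rewrite /N heap_nodes_cons leq_addr.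
rewrite /rot all_cat andbC -all_cat cat_take_drop; split=> //.
(* The potential ignores the order of the roots, so the rotation can be undone. *)
rewrite potential_cat addnC [X in X + _]addnC -potential_cat cat_take_drop.
have ->: potential (pmap id B) = 4 * size (pmap id B) + debts (pmap id B).
  by move: fB; rewrite all_count /potential => /eqP ->.
have := size_pmap_le B; rewrite potential_cons /= -/(debts c) dB cats0.
move: tf tB; rewrite potential_cons /= -/(debts c) sc addn0.
lia.
Qed.

(** * Sequences of operations *)

Definition live (s : state K E) : seq heap := pmap id s.

Definition state_potential (s : state K E) : nat :=
  sumn (map potential (live s)).

Definition opt_potential (x : option heap) : nat := oapp potential 0 x.

(** Stated without subtraction, and with [None] worth 0, so that it covers replacing, creating and
    destroying a heap. *)
Lemma state_potential_set (s : state K E) (i : nat) (x : option heap) :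
  state_potential (set_nth None s i x) + opt_potential (nth None s i) =
  state_potential s + opt_potential x.
Proof.
rewrite /state_potential /live.
have [l1 [l2 [-> /(_ x) ->]]] := pmap_set_nth s i.
by rewrite !map_cat !sumn_cat; case: x (nth _ _ _) => [h|] [h'|] /=; lia.
Qed.

Lemma well_ranked_nth (s : state K E) (i : nat) (h : heap) :
  all (all well_ranked) (live s) -> nth None s i = Some h -> all well_ranked h.
Proof.
rewrite /live; have [l1 [l2 [-> _]]] := pmap_set_nth s i.
by rewrite !all_cat => + E1; rewrite E1 /= => /and3P[_ /andP[]].
Qed.

Lemma well_ranked_set (s : state K E) (i : nat) (x : option heap) :
  all (all well_ranked) (live s) -> oapp (all well_ranked) true x ->
  all (all well_ranked) (live (set_nth None s i x)).
Proof.
rewrite /live; have [l1 [l2 [-> /(_ x) ->]]] := pmap_set_nth s i.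
by rewrite !all_cat => /and3P[-> _ ->]; case: x => //= h ->.
Qed.

Lemma step_correct (s s' : state K E) (o : operation K E) (n : nat) :
  step s o n s' -> all (all well_ranked) (live s) ->
  all (all well_ranked) (live s') /\
  n + state_potential s' <= allowance 20 s o + state_potential s.
Proof.
move=> st ws; case: st ws => {s o n s'} [s|s i h _|s e k i h h' Eh _ ins|
    s i h e n h' Eh _ del|s i j h1 h2 h ij Eh1 Eh2 mld|s e k i h n h' Eh dec|
    s e i h n h' Eh del] ws.
- rewrite /state_potential /live -cats1 pmap_cat all_cat ws map_cat sumn_cat.
  by split=> //; rewrite [sumn (map _ (pmap _ [:: _]))]/= /potential /debts /=; lia.
- by split=> //=; lia.
- split.
    apply: well_ranked_set => //=.
    by rewrite (well_ranked_meld ins) /= (well_ranked_nth ws Eh).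
  have := state_potential_set s i (Some h'); rewrite Eh /=.
  by rewrite (potential_meld ins) potential_cons /potential /debts /=; lia.
- have [wh' le_n] := delete_correct del (well_ranked_nth ws Eh).
  split; first exact: well_ranked_set.
  have := state_potential_set s i (Some h').
  by rewrite /= /nodes_of Eh /=; lia.
- split.
    apply: well_ranked_set; first exact: well_ranked_set.
    rewrite /= (well_ranked_meld mld).
    by rewrite (well_ranked_nth ws Eh1) (well_ranked_nth ws Eh2).
  have := state_potential_set (set_nth None s j None) i (Some h).
  have := state_potential_set s j None.
  (* As [i] and [j] differ, clearing entry [j] leaves [h1] at entry [i], and the two changes of
     potential add up. *)
  rewrite nth_set_nth /= (negbTE ij) Eh1 Eh2 /= (potential_meld mld).
  lia.
- have wh := well_ranked_nth ws Eh.
  split.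
    by apply: well_ranked_set => //=; apply: well_ranked_decrease_key dec wh.
  have := amortized_decrease_key dec wh.
  by have := state_potential_set s i (Some h'); rewrite Eh /=; lia.
have [wh' le_n] := delete_correct del (well_ranked_nth ws Eh).
split; first exact: well_ranked_set.
have := state_potential_set s i (Some h').
by rewrite /= /nodes_of Eh /=; lia.
Qed.

(** The potentials telescope from the empty state, whose potential is 0. *)
Lemma execution_correct (tr : seq (event K E)) (s : state K E) :
  execution tr s ->
  all (all well_ranked) (live s) /\
  \sum_(x <- tr) time x + state_potential s <=
    \sum_(x <- tr) allowance 20 (before x) (performed x).
Proof.
elim=> {tr s} [|tr s o n s' _ [ws IH] st]; first by rewrite !big_nil.
have [ws' le_n] := step_correct st ws; split=> //.
by rewrite -cats1 !big_cat !big_seq1 /=; lia.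
Qed.

End HollowHeapAnalysis.

Theorem theorem2p4 :
  exists c : nat,
    forall (d : Order.disp_t) (K : orderType d) (E : eqType)
           (tr : seq (event K E)) (s : state K E),
      execution tr s ->
      \sum_(x <- tr) time x <=
        \sum_(x <- tr) allowance c (before x) (performed x).
Proof.
exists 20 => d K E tr s /execution_correct[_]; exact: leq_trans (leq_addr _ _).
Qed.
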